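(* The following two statements are equivalent. (1) (Hindman's finite sums theorem) For every positive integer $k$ and every coloring $c:\{1,2,3,\dots\}\to\{0,1,\dots,k-1\}$ of the positive integers, there exists an infinite increasing sequence $X=(x_j)_{j\in\mathbf{N}}$ of positive integers such that all finite non-empty sums of distinct elements of $X$ have the same color under $c$. (2) (Theorem A) For every positive integer $k$ and every invariant coloring $f:\mathcal{E}(\mathbf{N})\to\{0,1,\dots,k-1\}$, there exists an infinite increasing sequence $S$ of positive integers such that $f$ is constant on all (finite) non-empty subsets of $S$ of even cardinality, i.e. $f$ is constant on $\mathcal{E}(S)$.
   Context: $\mathbf{N}=\{0,1,2,\dots\}$. For a set $X\subseteq\mathbf{N}$, $\mathcal{E}(X)$ denotes the set of all finite non-empty subsets of $X$ with even cardinality; an increasing sequence is identified with the set of its terms. For $Y\in\mathcal{E}(\mathbf{N})$ with increasing enumeration $y_1<y_2<\dots<y_{2n}$, define the alternating sum of consecutive differences $$A(Y):=\sum_{i=1}^{n}(y_{2i}-y_{2i-1}).$$ A coloring $f:\mathcal{E}(\mathbf{N})\to\{0,1,\dots,k-1\}$ is called invariant if for all $Y,Z\in\mathcal{E}(\mathbf{N})$ with $A(Y)=A(Z)$ one has $f(Y)=f(Z)$. *)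

(* Defs.v *)
From mathcomp Require Import all_boot all_order finmap.
From mathcomp Require Import boolp classical_sets.

Set Implicit Arguments.
Unset Strict Implicit.
Unset Printing Implicit Defensive.

Local Open Scope fset_scope.
Local Open Scope classical_set_scope.

Definition positives : set nat := [set n | 0 < n].

(* An increasing sequence is identified with its set of terms [range x]. *)
Definition increasing_pos_seq (x : nat -> nat) : Prop :=
  {homo x : i j / i < j} /\ (forall j, 0 < x j).

Definition finite_sums (X : set nat) : set nat :=
  [set n | exists F : {fset nat},
     [/\ [set` F] `<=` X, F != fset0 & n = \sum_(y <- F) y]].

Definition even_subsets (X : set nat) : set {fset nat} :=
  [set Y : {fset nat} | [/\ [set` Y] `<=` X, Y != fset0 & ~~ odd #|` Y|]].

(* The enumeration is indexed from 0, so y_j is [nth 0 s j.-1].  The list [s]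
   is increasing, so no difference is truncated. *)
Definition alt_sum (Y : {fset nat}) : nat :=
  let s := sort leq Y in
  \sum_(i < #|` Y|./2) (nth 0 s i.*2.+1 - nth 0 s i.*2).

Definition invariant_coloring (k : nat) (f : even_subsets setT -> 'I_k) : Prop :=
  forall Y Z : even_subsets setT, alt_sum (val Y) = alt_sum (val Z) -> f Y = f Z.

(* Colorings are functions on the subtype of a set [D]; [A] is a subset of [D]. *)
Definition constant_on (T : Type) (D : set T) (k : nat) (f : D -> 'I_k)
    (A : set T) : Prop :=
  forall u v : D, A (val u) -> A (val v) -> f u = f v.

(* Main.v *)
Require Import Defs.
From mathcomp Require Import all_boot all_order finmap.
From mathcomp Require Import boolp classical_sets.

(** An invariant coloring [f] is a coloring of the positive integers through
    [n |-> f {0, n}], since [A {0, n} = n].  If [x] is monochromatic for the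
    finite sums, its partial sums solve Theorem A: a difference of partial sums
    is a sum of [x i] over an interval of indices, and the intervals occurring
    in [A(Y)] are disjoint.  Conversely, a coloring [c] gives the invariant
    coloring [Y |-> c (A Y)].  From a solution [S] one extracts a subsequence [t]
    that more than doubles at each step: the differences [t (2j+1) - t (2j)] are
    then strictly increasing, and their finite sums are alternating sums of
    subsets of [S]. *)

Set Implicit Arguments.
Unset Strict Implicit.
Unset Printing Implicit Defensive.

Local Open Scope fset_scope.
Local Open Scope classical_set_scope.
Local Open Scope nat_scope.

(** Induction removing two terms at a time, matching the recursion [alt_seq_cons2]. *)
Lemma pair_ind (T : Type) (P : seq T -> Prop) :
  P [::] -> (forall a b s, ~~ odd (size s) -> P s -> P [:: a, b & s]) ->
  forall s, ~~ odd (size s) -> P s.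
Proof.
move=> P0 P2 s; have [n] := ubnP (size s).
elim: n s => // n IHn [|a [|b s]] //= ltsn; rewrite negbK => ev_s.
by apply: P2 => //; apply: IHn => //; rewrite -ltnS ltnW.
Qed.

(** * Finite sets of naturals as increasing lists *)

Lemma sort_leq_sorted_ltn (Y : {fset nat}) : sorted ltn (sort leq Y).
Proof.
rewrite ltn_sorted_uniq_leq sort_uniq fset_uniq /=.
by apply: sort_sorted; exact: leq_total.
Qed.

Lemma sort_leq_fset (s : seq nat) :
  sorted ltn s -> sort leq [fset y in s]%fset = s.
Proof.
move=> s_sorted; apply: (irr_sorted_eq ltn_trans ltnn) => //.
  exact: sort_leq_sorted_ltn.
by move=> y; rewrite mem_sort !inE.
Qed.

Lemma sorted_map_homo (x : nat -> nat) (js : seq nat) :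
  {homo x : i j / i < j} -> sorted ltn (map x js) = sorted ltn js.
Proof.
move=> x_incr; rewrite sorted_map.
by apply: eq_sorted => i j /=; apply: (leqW_mono (leq_mono x_incr)).
Qed.

Lemma fset_rangeE (x : nat -> nat) (Y : {fset nat}) :
  {homo x : i j / i < j} -> [set` Y] `<=` range x ->
  exists2 js, sorted ltn js & sort leq Y = map x js.
Proof.
move=> x_incr subY.
(* Preimages may be chosen term by term: [x] reflects the order, so the list of indices is
   automatically increasing. *)
suff [js def_js] : exists js, sort leq Y = map x js.
  exists js => //; rewrite -(sorted_map_homo _ x_incr) -def_js.
  exact: sort_leq_sorted_ltn.
have: forall y, y \in sort leq Y -> range x y.
  by move=> y; rewrite mem_sort; apply: subY.
elim: (sort leq Y) => [|y s IHs] ran_s; first by exists [::].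
have [j _ def_y] := ran_s y (mem_head _ _).
have [z s_z|js def_s] := IHs; first by apply: ran_s; rewrite inE s_z orbT.
by exists (j :: js); rewrite /= def_y def_s.
Qed.

Lemma fset_seq_range (x : nat -> nat) (js : seq nat) :
  [set` [fset y in map x js]%fset] `<=` range x.
Proof. by move=> y /=; rewrite inE => /mapP[j _ ->]; exists j. Qed.

(** * Alternating sums and finite sums through lists of indices *)

Definition alt_seq (s : seq nat) : nat :=
  \sum_(i < (size s)./2) (nth 0 s i.*2.+1 - nth 0 s i.*2).

Lemma alt_seq_nil : alt_seq [::] = 0.
Proof. by rewrite /alt_seq big_ord0. Qed.

Lemma alt_seq_cons2 a b s : alt_seq [:: a, b & s] = (b - a) + alt_seq s.
Proof. by rewrite /alt_seq /= big_ord_recl. Qed.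

Lemma alt_sumE (Y : {fset nat}) : alt_sum Y = alt_seq (sort leq Y).
Proof. by rewrite /alt_seq size_sort. Qed.

(** An increasing [x] is injective, so distinct terms are the same as distinct indices. *)
Lemma finite_sumsP (x : nat -> nat) n : {homo x : i j / i < j} ->
  finite_sums (range x) n <->
  exists js, [/\ sorted ltn js, js != [::] & n = \sum_(j <- js) x j].
Proof.
move=> x_incr; split=> [[F [subF F0 ->]]|[js [js_sorted js0 ->]]].
  have [js js_sorted def_F] := fset_rangeE x_incr subF.
  exists js; split=> //.
    apply: contraNneq F0 => js0; move: def_F; rewrite js0 => /(congr1 size).
    by rewrite size_sort => /eqP; rewrite cardfs_eq0.
  by rewrite -(big_map x xpredT id) -def_F; apply/perm_big; rewrite perm_sym perm_sort.
have xjs_sorted: sorted ltn (map x js) by rewrite sorted_map_homo.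
exists [fset y in map x js]%fset; split; first exact: fset_seq_range.
  by rewrite -cardfs_gt0 -(size_sort leq) sort_leq_fset // size_map lt0n size_eq0.
rewrite -(big_map x xpredT id) -[in LHS](sort_leq_fset xjs_sorted).
by apply/perm_big; rewrite perm_sort.
Qed.

Lemma even_subsets_range (t : nat -> nat) (Y : {fset nat}) :
  {homo t : i j / i < j} -> even_subsets (range t) Y ->
  exists js, [/\ sorted ltn js, js != [::], ~~ odd (size js)
               & alt_sum Y = alt_seq (map t js)].
Proof.
move=> t_incr [subY Y0 evY].
have [js js_sorted def_Y] := fset_rangeE t_incr subY.
have sz_js : size js = #|` Y| by rewrite -(size_map t) -def_Y size_sort.
exists js; split=> //; rewrite ?alt_sumE ?def_Y ?sz_js //.
by rewrite -size_eq0 sz_js cardfs_eq0.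
Qed.

Lemma even_subsets_fset (t : nat -> nat) (js : seq nat) :
  {homo t : i j / i < j} -> sorted ltn js -> js != [::] -> ~~ odd (size js) ->
  even_subsets (range t) [fset y in map t js]%fset
  /\ alt_sum [fset y in map t js]%fset = alt_seq (map t js).
Proof.
move=> t_incr js_sorted js0 ev_js.
have def_Y : sort leq [fset y in map t js]%fset = map t js.
  by rewrite sort_leq_fset ?sorted_map_homo.
have sz_Y : #|` [fset y in map t js]%fset| = size js.
  by rewrite -(size_map t js) -[in RHS]def_Y size_sort.
split; last by rewrite alt_sumE def_Y.
split; first exact: fset_seq_range.
  by rewrite -cardfs_gt0 sz_Y lt0n size_eq0.
by rewrite sz_Y.
Qed.

Lemma even_subsetsS (X X' : set nat) :
  X `<=` X' -> even_subsets X `<=` even_subsets X'.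
Proof. by move=> subX Y [subY Y0 evY]; split=> //; apply: subset_trans subX. Qed.

(** The first pair alone contributes a positive difference. Taking [id] as the sequence makes
    indices and terms coincide. *)
Lemma alt_sum_gt0 (Y : {fset nat}) : even_subsets setT Y -> 0 < alt_sum Y.
Proof.
move=> evY; have [||[|a [|b js]] [//= /andP[ltab _] _ _ ->]] :=
  @even_subsets_range id Y.
- by [].
- by apply: even_subsetsS evY => y _; exists y.
by rewrite /= alt_seq_cons2 ltn_addr // subn_gt0.
Qed.

(** * Partial sums: alternating sums become finite sums *)

Definition partial_sum (x : nat -> nat) (j : nat) : nat := \sum_(i < j.+1) x i.

Lemma partial_sum_increasing (x : nat -> nat) :
  (forall j, 0 < x j) -> increasing_pos_seq (partial_sum x).
Proof.
move=> x_gt0; split.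
  apply: homo_ltn => [|j]; first exact: ltn_trans.
  by rewrite /partial_sum [X in _ < X]big_ord_recr /= -addn1 leq_add2l.
by move=> j; rewrite /partial_sum big_ord_recr /= ltn_addl.
Qed.

(** Since [partial_sum x a] includes [x a], the remaining indices run from [a.+1] to [b]. *)
Lemma partial_sum_sub (x : nat -> nat) a b : a <= b ->
  partial_sum x b - partial_sum x a = \sum_(i <- iota a.+1 (b - a)) x i.
Proof.
move=> leab; rewrite /partial_sum -!(big_mkord xpredT x).
by rewrite (@big_cat_nat _ _ _ a.+1 0 b.+1) //= addKn /index_iota subSS.
Qed.

(** Each pair [a < b] contributes the interval of indices from [a.+1] to [b]. The clause on [path]
    strengthens the induction: strict lower bounds of [js] remain strict lower bounds of [ks], so
    the interval ending at [b] can be put in front of the later ones. *)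
Lemma alt_seq_partial_sum (x : nat -> nat) (js : seq nat) :
  ~~ odd (size js) -> sorted ltn js ->
  exists2 ks, sorted ltn ks &
    (forall m, path ltn m js -> path ltn m ks) /\
    alt_seq (map (partial_sum x) js) = \sum_(i <- ks) x i.
Proof.
move: js; apply: pair_ind => [_|a b js _ IHjs /= /andP[ltab bjs]].
  by exists [::] => //; split=> //; rewrite alt_seq_nil big_nil.
have [ks ks_sorted [path_ks sum_ks]] := IHjs (path_sorted bjs).
have path_int m : m <= a -> path ltn m (iota a.+1 (b - a) ++ ks).
  move=> lema; rewrite cat_path; apply/andP; split.
    have := iota_ltn_sorted a.+1 (b - a).
    by rewrite -(subnSK ltab) /= ltnS lema.
  suff ->: last m (iota a.+1 (b - a)) = b by apply: path_ks.
  by rewrite -nth_last size_iota -subnS nth_iota ?subnSK ?subnKC.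
exists (iota a.+1 (b - a) ++ ks); first exact: path_sorted (path_int a _).
split=> [m /andP[ltma _]|]; first exact/path_int/ltnW.
by rewrite alt_seq_cons2 partial_sum_sub 1?ltnW // sum_ks big_cat.
Qed.

Lemma alt_sum_partial_sum (x : nat -> nat) (Y : {fset nat}) :
  increasing_pos_seq x -> even_subsets (range (partial_sum x)) Y ->
  finite_sums (range x) (alt_sum Y).
Proof.
move=> [x_incr x_gt0] evY; apply/finite_sumsP => //.
have [s_incr _] := partial_sum_increasing x_gt0.
have [js [js_sorted _ ev_js def_Y]] := even_subsets_range s_incr evY.
have [ks ks_sorted [_ sum_ks]] := alt_seq_partial_sum x ev_js js_sorted.
exists ks; split=> //; last by rewrite def_Y.
(* An empty [ks] would make the alternating sum zero. *)
have: 0 < alt_sum Y by apply/alt_sum_gt0/(even_subsetsS _ evY).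
by apply: contraTneq => ks0; rewrite def_Y sum_ks ks0 big_nil.
Qed.

(** * Sparse subsequences: finite sums become alternating sums *)

Fixpoint doubling_subseq (s : nat -> nat) (j : nat) : nat :=
  if j is i.+1 then s (doubling_subseq s i).*2.+1 else s 0.

Definition pair_diff (t : nat -> nat) (j : nat) : nat := t j.*2.+1 - t j.*2.

Lemma doubling_subseq_double (s : nat -> nat) j : {homo s : i j / i < j} ->
  (doubling_subseq s j).*2 < doubling_subseq s j.+1.
Proof.
move=> s_incr /=.
(* As [m < n] is [m.+1 <= n], the goal is an instance of [i <= s i], which holds for every
   increasing [s]; hence the index [.*2.+1] in the definition. *)
by elim: _.*2.+1 => // i IHi; apply: leq_ltn_trans IHi (s_incr _ _ (ltnSn i)).
Qed.

Lemma doubling_subseq_incr (s : nat -> nat) : {homo s : i j / i < j} ->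
  {homo doubling_subseq s : i j / i < j}.
Proof.
move=> s_incr; apply: homo_ltn => [|j]; first exact: ltn_trans.
by apply: leq_ltn_trans (doubling_subseq_double j s_incr); rewrite -addnn leq_addl.
Qed.

Lemma range_doubling_subseq (s : nat -> nat) :
  range (doubling_subseq s) `<=` range s.
Proof. by move=> _ [[|j] _ <-]; [exists 0 | exists (doubling_subseq s j).*2.+1]. Qed.

(** With [t] the subsequence, [t (2j+1) - t (2j) <= t (2j+1) < t (2j+2) < t (2j+3) - t (2j+2)], the
    last step by doubling. *)
Lemma pair_diff_increasing (s : nat -> nat) : {homo s : i j / i < j} ->
  increasing_pos_seq (pair_diff (doubling_subseq s)).
Proof.
move=> s_incr; have t_incr := doubling_subseq_incr s_incr.
split=> [|j]; last by rewrite subn_gt0 t_incr.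
apply: homo_ltn => [|j]; first exact: ltn_trans.
apply: leq_ltn_trans (leq_subr _ _) _; apply: ltn_trans (t_incr _ j.*2.+2 _) _ => //.
rewrite /pair_diff doubleS ltn_subRL addnn.
exact: doubling_subseq_double.
Qed.

(** Selecting both indices of each chosen pair makes the alternating sum of [t] pair them up
    again. *)
Definition double_indices (js : seq nat) : seq nat :=
  flatten [seq [:: j.*2; j.*2.+1] | j <- js].

Lemma double_indices_sorted (js : seq nat) :
  sorted ltn js -> sorted ltn (double_indices js).
Proof.
have path_dbl j ks : path ltn j ks -> path ltn j.*2.+1 (double_indices ks).
  elim: ks j => //= k ks IHks j /andP[ltjk kks].
  by rewrite ltnSn IHks // -doubleS ltn_Sdouble ?ltjk.
by case: js => //= j js /path_dbl ->; rewrite ltnSn.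
Qed.

Lemma double_indices_even (js : seq nat) : ~~ odd (size (double_indices js)).
Proof. by elim: js => //= j js; rewrite negbK. Qed.

Lemma alt_seq_double_indices (t : nat -> nat) (js : seq nat) :
  alt_seq (map t (double_indices js)) = \sum_(j <- js) pair_diff t j.
Proof.
elim: js => [|j js IHjs]; first by rewrite alt_seq_nil big_nil.
by rewrite /= alt_seq_cons2 IHjs big_cons.
Qed.

Lemma finite_sums_pair_diff (s : nat -> nat) n : {homo s : i j / i < j} ->
  finite_sums (range (pair_diff (doubling_subseq s))) n ->
  exists2 Y, even_subsets (range s) Y & alt_sum Y = n.
Proof.
move=> s_incr; have [x_incr _] := pair_diff_increasing s_incr.
move=> /(finite_sumsP _ x_incr) [js [js_sorted js0 ->]].
have [||||evY def_Y] := @even_subsets_fset (doubling_subseq s) (double_indices js).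
- exact: doubling_subseq_incr.
- exact: double_indices_sorted.
- by case: js js0 {js_sorted}.
- exact: double_indices_even.
rewrite -alt_seq_double_indices -def_Y; eexists; last by [].
exact: even_subsetsS (@range_doubling_subseq s) _ evY.
Qed.

(** * Transfer of colorings between the two statements *)

Lemma even_subset_pair0 n : 0 < n ->
  exists2 Y, even_subsets setT Y & alt_sum Y = n.
Proof.
move=> n_gt0; have [//||//|//|evY def_Y] := @even_subsets_fset id [:: 0; n].
  by rewrite /= n_gt0.
exists [fset y in map id [:: 0; n]]%fset; first exact: even_subsetsS evY.
by rewrite def_Y alt_seq_cons2 alt_seq_nil addn0 subn0.
Qed.

Theorem theorem1p1 :
  (forall k : nat, (0 < k)%N -> forall c : positives -> 'I_k,
     exists2 x : nat -> nat, increasing_pos_seq x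
       & constant_on c (finite_sums (range x)))
  <->
  (forall k : nat, (0 < k)%N ->
   forall f : even_subsets [set: nat] -> 'I_k, invariant_coloring f ->
     exists2 x : nat -> nat, increasing_pos_seq x
       & constant_on f (even_subsets (range x))).
Proof.
split=> [hindman k k_gt0 f f_inv|thmA k k_gt0 c].
  have exY (n : positives) : exists Y : even_subsets setT, alt_sum (val Y) = val n.
    have [Y evY def_n] := even_subset_pair0 (set_mem (valP n)).
    by exists (exist _ Y (mem_set evY)).
  (* Any choice of a set [g n] with alternating sum [n] will do, since [f] is invariant. *)
  have [g gE] := choice exY.
  have [x x_incr c_const] := hindman k k_gt0 (f \o g).
  exists (partial_sum x); first exact: partial_sum_increasing (proj2 x_incr).
  move=> Y Z evY evZ.
  pose A (W : even_subsets setT) : positives :=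
    exist _ (alt_sum (val W)) (mem_set (alt_sum_gt0 (set_mem (valP W)))).
  (* Thus [f] is the pullback along [A] of the coloring [f \o g] of the positive integers. *)
  have fE W : f W = f (g (A W)) by apply: f_inv; rewrite gE.
  rewrite (fE Y) (fE Z).
  by apply: (c_const (A Y) (A Z)); apply: alt_sum_partial_sum.
pose A (W : even_subsets setT) : positives :=
  exist _ (alt_sum (val W)) (mem_set (alt_sum_gt0 (set_mem (valP W)))).
have [|s [s_incr _] f_const] := thmA k k_gt0 (c \o A).
  by move=> Y Z eqA; congr (c _); apply: val_inj.
exists (pair_diff (doubling_subseq s)); first exact: pair_diff_increasing.
(* Every finite sum is [A W] for some [W] inside the solution [s], so its color under [c] is that of
   [W] under [c \o A]. *)
have cE (n : positives) : finite_sums (range (pair_diff (doubling_subseq s))) (val n) ->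
    exists2 W : even_subsets setT, even_subsets (range s) (val W) & n = A W.
  move=> /(finite_sums_pair_diff s_incr)[Y evY def_n].
  exists (exist _ Y (mem_set (even_subsetsS (@subsetT _ _) evY))) => //.
  exact: val_inj.
by move=> m n /cE[Y evY ->] /cE[Z evZ ->]; apply: f_const.
Qed.
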